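(* Let $A_1,A_2\in\mathbb{R}^{n\times n}$ be symmetric matrices, $a,b\in\mathbb{R}^n$, $a_0,b_0\in\mathbb{R}$, and let $f_1(x)=x^TA_1x+2a^Tx+a_0$ and $f_2(x)=x^TA_2x+2b^Tx+b_0$ for $x\in\mathbb{R}^n$. Let $F:\mathbb{R}^2\to\mathbb{R}$ be defined by $F(z)=z_1^2+z_2^2$ for $z=(z_1,z_2)^T$. Suppose that $\{A_1,A_2\}$ is linearly independent and let $\gamma\in\mathbb{R}$. Then the following two statements are equivalent: (G1) For all $x\in\mathbb{R}^n$ and $z\in\mathbb{R}^2$: if $f_1(x)-z_1=0$ and $f_2(x)-z_2=0$, then $F(z)-\gamma\ge 0$. (G2) There exist $\alpha,\beta\in\mathbb{R}$ such that $F(z)-\gamma+\alpha(f_1(x)-z_1)+\beta(f_2(x)-z_2)\ge 0$ for all $(x,z)\in\mathbb{R}^n\times\mathbb{R}^2$.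
   Context: Linear independence of $\{A_1,A_2\}$ is in the real vector space of symmetric $n\times n$ matrices. *)

(* Defs.v *)
From mathcomp Require Import all_boot all_order all_algebra.
From mathcomp Require Import reals.

Set Implicit Arguments.
Unset Strict Implicit.
Unset Printing Implicit Defensive.

Import Order.TTheory GRing.Theory Num.Theory.

Local Open Scope ring_scope.

Definition quadfun (R : realType) (n : nat) (A : 'M[R]_n) (a : 'cV[R]_n)
    (a0 : R) (x : 'cV[R]_n) : R :=
  (x^T *m A *m x) 0 0 + 2 * (a^T *m x) 0 0 + a0.

(* [z 0 0] and [z 1 0] are the first and second coordinates of [z]. *)
Definition sqsum2 (R : realType) (z : 'cV[R]_2) : R :=
  z 0 0 ^+ 2 + z 1 0 ^+ 2.

(* Main.v *)
(** With [W] the joint range of [f1] and [f2], (G1) says that [W] avoids the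
    open disc of radius [sqrt gamma], while (G2) says, after minimizing over [z],
    that a line separates [W] from that disc.  So it is enough that [W] is convex.

    Let [m] be a point of the segment joining [f(x)] and [f(y)]; recombining, one
    gets quadratic functions [g], [h] with [g = 0] at [x] and [y] and
    [h(x) < 0 < h(y)], whose common zeros are the preimages of [m].  If [g]
    vanishes identically on the line [xy], the intermediate value theorem applies
    to [h] there.  Otherwise subtract from [h] the multiple of [g] that makes [h]
    affine on that line.  By independence the new quadratic part of [h] is
    nonzero, so it does not vanish at some direction [v], and a common zero exists
    already in the plane [x + t (y - x) + s v]: solve [h = 0] for [t] as a
    rational function of [s] and apply the intermediate value theorem to [g]. *)
Require Import Defs.
From mathcomp Require Import all_boot all_order all_algebra.
From mathcomp Require Import ring lra boolp classical_sets reals polyrcf.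

Set Implicit Arguments.
Unset Strict Implicit.
Unset Printing Implicit Defensive.

Import Order.TTheory GRing.Theory Num.Theory.

Local Open Scope ring_scope.

(** * Real roots of polynomials and a planar system of two quadratic equations *)

Lemma poly_root_ge (R : rcfType) (p : {poly R}) (x : R) :
  p.[x] <= 0 -> 0 < lead_coef p -> exists y, p.[y] = 0.
Proof.
move=> px lcp; have [n pn] := poly_pinfty_gt_lc lcp.
have py : 0 <= p.[Num.max x n].
  by apply: ltW; apply: lt_le_trans lcp _; apply: pn; rewrite le_max lexx orbT.
have [||y _ /rootP] := @poly_ivt R p x (Num.max x n).
- by rewrite le_max lexx.
- by rewrite px.
- by exists y.
Qed.

Lemma poly_root_between (R : rcfType) (p : {poly R}) (x y : R) :
  p.[x] * p.[y] <= 0 -> exists z, p.[z] = 0.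
Proof.
wlog lexy : x y / x <= y => [H|pxy].
  by case: (leP x y) => [/H//|/ltW/H]; rewrite mulrC.
by have [//|//|z _ /rootP] := @polyrcf.poly_ivt R p x y; exists z.
Qed.

(** The first equation is [g], scaled so that it is [t ^+ 2 - t] on the line [s = 0]; the second is
    [h], affine there with a sign change. Eliminating [t] leaves a function of [s] that is negative
    at [s = 0], because [- h0 / k] lies strictly between 0 and 1. *)
Lemma plane_zero (R : rcfType) (p q r h0 k b a l : R) :
    h0 < 0 -> 0 < h0 + k -> a != 0 ->
  exists t s,
    t ^+ 2 - t + p * t * s + q * s ^+ 2 + r * s = 0 /\
    h0 + k * t + b * t * s + a * s ^+ 2 + l * s = 0.
Proof.
move=> h0_lt0 hk a0.
have k_gt0 : 0 < k by lra.
have k0 : k != 0 by rewrite gt_eqF.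
have hk_lt0 : h0 ^+ 2 + h0 * k < 0 by nra.
have aa : 0 < a ^+ 2 by rewrite exprn_even_gt0.
have [->|b0] := eqVneq b 0.
  (* [P] is [k ^+ 2] times the first equation at [t = - (h0 + l * s + a * s ^+ 2) / k]. *)
  pose P := Poly [:: h0 ^+ 2 + h0 * k;
                    2 * l * h0 + l * k - p * h0 * k + r * k ^+ 2;
                    l ^+ 2 + 2 * a * h0 + a * k - p * l * k + q * k ^+ 2;
                    2 * a * l - p * a * k; a ^+ 2].
  have [||s Ps] := @poly_root_ge R P 0.
  - by rewrite horner_Poly /=; lra.
  - by rewrite /lead_coef (PolyK (c := 0)) /= ?gt_eqF.
  exists (- (h0 + l * s + a * s ^+ 2) / k), s; split; last by field.
  apply: (mulIf (expf_neq0 2 k0)); rewrite mul0r; transitivity P.[s] => //.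
  rewrite horner_Poly /=.
  by field.
pose N s := - (h0 + l * s + a * s ^+ 2).
(* The second equation gives [t = N s / (k + b * s)], with a possible pole at [s1]. *)
pose s1 := - k / b.
have bs1 : k + b * s1 = 0 by rewrite /s1; field.
have [Ns1|Ns1] := eqVneq (N s1) 0; last first.
  pose NP := - (h0%:P + l *: 'X + a *: 'X^2).
  pose DP := k%:P + b *: 'X.
  pose P := NP ^+ 2 - NP * DP + p *: 'X * NP * DP
            + (q *: 'X^2 + r *: 'X) * DP ^+ 2.
  have PE s : P.[s] = N s ^+ 2 - N s * (k + b * s) + p * s * N s * (k + b * s)
                      + (q * s ^+ 2 + r * s) * (k + b * s) ^+ 2.
    by rewrite /P /NP /DP /N !hornerE.
  (* At [s1] only [N s1 ^+ 2] survives, so [P] changes sign between 0 and [s1], and the root found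
     is not the pole. *)
  have Ps1 : 0 < P.[s1].
    by rewrite PE bs1 !mulr0 subr0 expr0n /= mulr0 !addr0 exprn_even_gt0.
  have [|s Ps] := @poly_root_between R P 0 s1.
    apply: mulr_le0_ge0; last exact: ltW.
    by rewrite PE /N; lra.
  have D0 : k + b * s != 0.
    apply/eqP => Ds; have ss : s = s1.
      by rewrite /s1; apply: (mulfI b0); rewrite mulrCA divff //; lra.
    by move: Ps1; rewrite -ss Ps ltxx.
  exists (N s / (k + b * s)), s; split; last by rewrite /N; field.
  apply: (mulIf (expf_neq0 2 D0)); rewrite mul0r; transitivity P.[s] => //.
  rewrite PE.
  by field.
(* Numerator and denominator of [t] both vanish at [s1]: the second equation
   factors, and its zero set is the union of the lines [s = s1] and [t = L s]. *)
pose G t s := t ^+ 2 - t + p * t * s + q * s ^+ 2 + r * s.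
pose L s := - h0 / k - a / b * s.
have HL s : h0 + k * L s + b * L s * s + a * s ^+ 2 + l * s = 0.
  have lE : l = b * h0 / k + a * k / b.
    have bk0 : b / k != 0 by rewrite mulf_neq0 ?invr_eq0.
    apply/eqP; rewrite -subr_eq0; apply/eqP.
    transitivity (N s1 * (b / k)); last by rewrite Ns1 mul0r.
    by rewrite /N /s1; field; rewrite b0 k0.
  by rewrite lE /L; field; rewrite b0 k0.
(* The lines meet at [t = L s1], [s = s1]. If [G <= 0] there, [G], monic in [t], has a root on
   [s = s1]; otherwise it changes sign along [t = L s] between [s = 0] and [s1]. *)
have [Gs1|Gs1] := leP (G (L s1) s1) 0.
  pose P := Poly [:: q * s1 ^+ 2 + r * s1; p * s1 - 1; 1].
  have PE t : P.[t] = G t s1 by rewrite horner_Poly /= /G; ring.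
  have [||t Pt] := @poly_root_ge R P (L s1).
  - by rewrite PE.
  - by rewrite /lead_coef (PolyK (c := 0)) /= ?oner_eq0 ?ltr01.
  exists t, s1; split; first exact: etrans (esym (PE t)) Pt.
  have -> : h0 + k * t + b * t * s1 + a * s1 ^+ 2 + l * s1
    = (k + b * s1) * t - N s1 by rewrite /N; ring.
  by rewrite bs1 Ns1; ring.
pose LP := (- h0 / k)%:P - (a / b) *: 'X.
pose P := LP ^+ 2 - LP + p *: 'X * LP + q *: 'X^2 + r *: 'X.
have PE s : P.[s] = G (L s) s by rewrite /P /LP /G /L !hornerE; ring.
have [|s Ps] := @poly_root_between R P 0 s1.
  rewrite !PE; apply: mulr_le0_ge0; last exact: ltW.
  have ->: G (L 0) 0 = (h0 ^+ 2 + h0 * k) / k ^+ 2.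
    by rewrite /G /L; field; rewrite k0.
  by rewrite ltW // pmulr_llt0 // invr_gt0 exprn_gt0.
by exists (L s), s; split=> //; exact: etrans (esym (PE s)) Ps.
Qed.

(** * Quadratic functions restricted to planes *)

Definition bilform (R : realType) n (A : 'M[R]_n) (u v : 'cV[R]_n) : R :=
  (u^T *m A *m v) 0 0.

Lemma bilformDl (R : realType) n (A : 'M[R]_n) u u' v :
  bilform A (u + u') v = bilform A u v + bilform A u' v.
Proof. by rewrite /bilform linearD /= !mulmxDl mxE. Qed.

Lemma bilformDr (R : realType) n (A : 'M[R]_n) u v v' :
  bilform A u (v + v') = bilform A u v + bilform A u v'.
Proof. by rewrite /bilform mulmxDr mxE. Qed.

Lemma bilformZl (R : realType) n (A : 'M[R]_n) k u v :
  bilform A (k *: u) v = k * bilform A u v.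
Proof. by rewrite /bilform linearZ /= -!scalemxAl mxE. Qed.

Lemma bilformZr (R : realType) n (A : 'M[R]_n) k u v :
  bilform A u (k *: v) = k * bilform A u v.
Proof. by rewrite /bilform -scalemxAr mxE. Qed.

Lemma bilform_comb (R : realType) n (A B : 'M[R]_n) k l u v :
  bilform (k *: A + l *: B) u v = k * bilform A u v + l * bilform B u v.
Proof.
rewrite /bilform mulmxDr mulmxDl -!scalemxAr -!scalemxAl mxE.
by congr (_ + _); rewrite mxE.
Qed.

Lemma sym_bilform_eq0 (R : realType) n (A : 'M[R]_n) :
  A^T = A -> (forall v, bilform A v v = 0) -> A = 0.
Proof.
move=> symA A0; apply/matrixP => i j.
have bE k l : bilform A (delta_mx k 0) (delta_mx l 0) = A k l.
  by rewrite /bilform trmx_delta -rowE -colE !mxE.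
have := A0 (delta_mx i 0 + delta_mx j 0).
rewrite bilformDl !bilformDr !A0 !bE.
have -> : A j i = A i j by rewrite -{1}symA mxE.
rewrite mxE; lra.
Qed.

(** Only the square coefficients are explicit; where [p] matters, it is recovered from the values at
    the two endpoints. *)
Lemma quadfun_plane (R : realType) n (A : 'M[R]_n) (a : 'cV[R]_n) (a0 : R)
    (x e v : 'cV[R]_n) : exists p q k, forall t s : R,
  quadfun A a a0 (x + t *: e + s *: v) =
    quadfun A a a0 x + p * t + bilform A e e * t ^+ 2 + k * t * s
    + bilform A v v * s ^+ 2 + q * s.
Proof.
exists (bilform A x e + bilform A e x + 2 * (a^T *m e) 0 0),
  (bilform A x v + bilform A v x + 2 * (a^T *m v) 0 0),
  (bilform A e v + bilform A v e) => t s.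
have lE : (a^T *m (x + t *: e + s *: v)) 0 0 =
    (a^T *m x) 0 0 + t * (a^T *m e) 0 0 + s * (a^T *m v) 0 0.
  rewrite !mulmxDr -!scalemxAr mxE; congr (_ + _); rewrite mxE //.
  by congr (_ + _); rewrite mxE.
rewrite /quadfun lE -!/(bilform _ _ _).
rewrite !(bilformDl, bilformDr, bilformZl, bilformZr).
ring.
Qed.

Lemma quadfun_comb (R : realType) n (A B : 'M[R]_n) (a b : 'cV[R]_n)
    (a0 b0 l m c : R) (x : 'cV[R]_n) :
  quadfun (l *: A + m *: B) (l *: a + m *: b) (l * a0 + m * b0 + c) x =
  l * quadfun A a a0 x + m * quadfun B b b0 x + c.
Proof.
have lE : ((l *: a + m *: b)^T *m x) 0 0 =
    l * (a^T *m x) 0 0 + m * (b^T *m x) 0 0.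
  rewrite linearD !linearZ /= mulmxDl -!scalemxAl mxE.
  by congr (_ + _); rewrite mxE.
rewrite /quadfun lE -!/(bilform _ _ _) bilform_comb.
ring.
Qed.

(** * Convexity of the joint range *)

Lemma common_zero (R : realType) n (A B : 'M[R]_n) (a b : 'cV[R]_n)
    (a0 b0 : R) (x y : 'cV[R]_n) :
    A^T = A -> B^T = B -> (forall k : R, B != k *: A) ->
    quadfun A a a0 x = 0 -> quadfun A a a0 y = 0 ->
    quadfun B b b0 x < 0 -> 0 < quadfun B b b0 y ->
  exists z, quadfun A a a0 z = 0 /\ quadfun B b b0 z = 0.
Proof.
move=> symA symB indep Ax Ay Bx By.
pose e := y - x.
have ye : y = x + 1 *: e + 0 *: (0 : 'cV[R]_n).
  by rewrite scale1r scale0r addr0 addrC subrK.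
have [c0|c0] := eqVneq (bilform A e e) 0.
  have [p [q [k AE]]] := quadfun_plane A a a0 x e 0.
  have [p' [q' [k' BE]]] := quadfun_plane B b b0 x e 0.
  (* Affine on the line and zero at both [x] and [y], the first function vanishes on all of it. *)
  have p0 : p = 0 by move: Ay; rewrite ye AE Ax c0; lra.
  pose P := Poly [:: quadfun B b b0 x; p'; bilform B e e].
  have PE t : P.[t] = quadfun B b b0 (x + t *: e + 0 *: 0).
    by rewrite BE horner_Poly /=; ring.
  have [|t Pt] := @poly_root_between R P 0 1.
    by rewrite !PE -ye !scale0r !addr0 mulr_le0_ge0 // ltW.
  exists (x + t *: e + 0 *: 0); split; last by rewrite -PE.
  by rewrite AE Ax c0 p0; ring.
set c := bilform A e e in c0.
(* Subtracting [m] times the first function cancels the [t ^+ 2] term of the second. *)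
pose m := bilform B e e / c.
have [v Cv] : exists v, bilform B v v - m * bilform A v v != 0.
  apply: contrapT => /forallNP Cv.
  have /eqP := indep m; apply; apply/eqP; rewrite -subr_eq0; apply/eqP.
  apply: sym_bilform_eq0 => [|v].
    by rewrite linearB linearZ /= symA symB.
  have := Cv v; move/negP; rewrite negbK => /eqP <-.
  by rewrite -scaleNr -{1}[B]scale1r bilform_comb mul1r mulNr.
have [p [q [k AE]]] := quadfun_plane A a a0 x e v.
have [p' [q' [k' BE]]] := quadfun_plane B b b0 x e v.
have ye' : y = x + 1 *: e + 0 *: v by rewrite ye !scale0r.
(* The first function is thus [c * (t ^+ 2 - t)] on the line; dividing by [c] gives the shape of
   [plane_zero]. *)
have pE : p = - c by move: Ay; rewrite ye' AE Ax -/c; lra.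
have [|t [s [At Bt]]] := @plane_zero R (k / c) (bilform A v v / c) (q / c)
  (quadfun B b b0 x) (p' - m * p) (k' - m * k)
  (bilform B v v - m * bilform A v v) (q' - m * q) Bx _ Cv.
  move: By; rewrite ye' BE pE; have -> : bilform B e e = m * c by rewrite divfK.
  lra.
have Az : quadfun A a a0 (x + t *: e + s *: v) = 0.
  transitivity (c * (t ^+ 2 - t + k / c * t * s + bilform A v v / c * s ^+ 2
                     + q / c * s)); last by rewrite At mulr0.
  by rewrite AE Ax pE -/c; field.
exists (x + t *: e + s *: v); split=> //.
transitivity (quadfun B b b0 (x + t *: e + s *: v)
              - m * quadfun A a a0 (x + t *: e + s *: v)).
  by rewrite Az mulr0 subr0.
rewrite -{}Bt BE AE Ax -/c.
have -> : bilform B e e = m * c by rewrite divfK.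
ring.
Qed.

(** [common_zero] applies to the components of the joint map, centred at the target point, across
    and along the chord between the two images. *)
Lemma joint_range_convex (R : realType) n (A B : 'M[R]_n) (a b : 'cV[R]_n)
    (a0 b0 : R) (x y : 'cV[R]_n) (m : R) :
    A^T = A -> B^T = B ->
    (forall k l : R, k *: A + l *: B = 0 -> k = 0 /\ l = 0) -> 0 <= m <= 1 ->
  exists z,
    quadfun A a a0 z = (1 - m) * quadfun A a a0 x + m * quadfun A a a0 y /\
    quadfun B b b0 z = (1 - m) * quadfun B b b0 x + m * quadfun B b b0 y.
Proof.
move=> symA symB indep /andP[m0 m1].
set f := quadfun A a a0; set g := quadfun B b b0.
pose c := f y - f x; pose d := g y - g x.
have [m_eq0|m_neq0] := eqVneq m 0.
  by exists x; rewrite m_eq0; split; ring.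
have [m_eq1|m_neq1] := eqVneq m 1.
  by exists y; rewrite m_eq1; split; ring.
have m_gt0 : 0 < m by rewrite lt_neqAle eq_sym m_neq0.
have m_lt1 : m < 1 by rewrite lt_neqAle m_neq1.
have [cd0|cd0] := eqVneq (c ^+ 2 + d ^+ 2) 0.
  have : c ^+ 2 + d ^+ 2 == 0 by apply/eqP.
  rewrite paddr_eq0 ?sqr_ge0 // !sqrf_eq0 => /andP[/eqP c0 /eqP d0].
  exists x; split.
    have -> : f y = f x by move: c0; rewrite /c; lra.
    by ring.
  have -> : g y = g x by move: d0; rewrite /d; lra.
  by ring.
have cd_gt0 : 0 < c ^+ 2 + d ^+ 2.
  by rewrite lt_neqAle eq_sym cd0 addr_ge0 ?sqr_ge0.
pose f0 := (1 - m) * f x + m * f y; pose g0 := (1 - m) * g x + m * g y.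
pose G := quadfun (d *: A + (- c) *: B) (d *: a + (- c) *: b)
  (d * a0 + (- c) * b0 + (c * g0 - d * f0)).
pose H := quadfun (c *: A + d *: B) (c *: a + d *: b)
  (c * a0 + d * b0 + (- c * f0 - d * g0)).
have GE z : G z = d * (f z - f0) - c * (g z - g0).
  by rewrite /G quadfun_comb -/f -/g; ring.
have HE z : H z = c * (f z - f0) + d * (g z - g0).
  by rewrite /H quadfun_comb -/f -/g; ring.
have [|||||||z [Gz Hz]] := @common_zero R n (d *: A + (- c) *: B)
  (c *: A + d *: B) (d *: a + (- c) *: b) (c *: a + d *: b)
  (d * a0 + (- c) * b0 + (c * g0 - d * f0)) 
  (c * a0 + d * b0 + (- c * f0 - d * g0)) x y; rewrite -?/(G _) -?/(H _).
- by rewrite linearD !linearZ /= symA symB.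
- by rewrite linearD !linearZ /= symA symB.
(* Proportional quadratic parts would force [c = k * d] and [d = - k * c], hence
   [c ^+ 2 + d ^+ 2 = 0]. *)
- move=> k; apply/eqP => kE.
  have [|k1 k2] := indep (c - k * d) (d + k * c).
    transitivity (c *: A + d *: B - k *: (d *: A + - c *: B)).
      by apply/matrixP => i j; rewrite !mxE; ring.
    by rewrite kE subrr.
  case/eqP: cd0; transitivity (c * (c - k * d) + d * (d + k * c)).
    by ring.
  by rewrite k1 k2 !mulr0 addr0.
- by rewrite GE /f0 /g0 /c /d; ring.
- by rewrite GE /f0 /g0 /c /d; ring.
- have -> : H x = - (m * (c ^+ 2 + d ^+ 2)) by rewrite HE /f0 /g0 /c /d; ring.
  by rewrite oppr_lt0 mulr_gt0.
- have -> : H y = (1 - m) * (c ^+ 2 + d ^+ 2) by rewrite HE /f0 /g0 /c /d; ring.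
  by rewrite mulr_gt0 // subr_gt0.
rewrite -/(G z) GE in Gz; rewrite -/(H z) HE in Hz.
(* Inverts the change of components, whose determinant is [c ^+ 2 + d ^+ 2]. *)
exists z; rewrite -/f0 -/g0; split; apply/eqP; rewrite -subr_eq0; apply/eqP;
  apply: (mulfI cd0); rewrite mulr0.
  transitivity (d * (d * (f z - f0) - c * (g z - g0)) +
    c * (c * (f z - f0) + d * (g z - g0))); first by ring.
  by rewrite Gz Hz !mulr0 addr0.
transitivity (d * (c * (f z - f0) + d * (g z - g0)) -
    c * (d * (f z - f0) - c * (g z - g0))); first by ring.
by rewrite Gz Hz !mulr0 subr0.
Qed.

(** * Separating a convex planar set from an open disc *)

(** A planar Hahn-Banach argument: a point [(p, q)] of [W] fixes the functional on one line, and a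
    supremum of slopes extends it to the plane. *)
Lemma separate_from_disc (R : realType) (W : R -> R -> Prop) (r : R) :
    0 < r ->
    (forall x y x' y' m, W x y -> W x' y' -> 0 <= m <= 1 ->
       W ((1 - m) * x + m * x') ((1 - m) * y + m * y')) ->
    (forall x y, W x y -> r ^+ 2 <= x ^+ 2 + y ^+ 2) ->
  exists u v, u ^+ 2 + v ^+ 2 = 1 /\ forall x y, W x y -> r <= u * x + v * y.
Proof.
move=> r0 Wconv Wout.
have [[p [q Wpq]]|W0] := pselect (exists p q, W p q); last first.
  exists 1, 0; split=> [|x y Wxy]; first by ring.
  by case: W0; exists x, y.
have pq_gt0 : 0 < p ^+ 2 + q ^+ 2.
  by apply: lt_le_trans (Wout _ _ Wpq); rewrite exprn_gt0.
pose D x y := x ^+ 2 + y ^+ 2 < r ^+ 2.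
pose dot x y := p * x + q * y.
pose cross x y := p * y - q * x.
(* Otherwise [(d, e)] is [(x, y) + k (p, q)] with [k > 0], and dividing it by [1 + k] gives a point
   of the segment from [(x, y)] to [(p, q)], hence of [W], inside the disc. *)
have dot_ge0 x y d e : W x y -> D d e -> cross (x - d) (y - e) = 0 ->
    0 <= dot (x - d) (y - e).
  move=> Wxy Dde cr0; rewrite leNgt; apply/negP => dot_lt0.
  pose k := - dot (x - d) (y - e) / (p ^+ 2 + q ^+ 2).
  have k_gt0 : 0 < k by rewrite divr_gt0 ?oppr_gt0.
  have k10 : 1 + k != 0 by rewrite gt_eqF //; lra.
  have xE : x + k * p = d.
    apply/eqP; rewrite -subr_eq0; apply/eqP.
    transitivity (- q * cross (x - d) (y - e) / (p ^+ 2 + q ^+ 2)).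
      by rewrite /k /dot /cross; field; rewrite gt_eqF.
    by rewrite cr0 mulr0 mul0r.
  have yE : y + k * q = e.
    apply/eqP; rewrite -subr_eq0; apply/eqP.
    transitivity (p * cross (x - d) (y - e) / (p ^+ 2 + q ^+ 2)).
      by rewrite /k /dot /cross; field; rewrite gt_eqF.
    by rewrite cr0 mulr0 mul0r.
  have m01 : 0 <= k / (1 + k) <= 1.
    by apply/andP; split; [apply: divr_ge0 | rewrite ler_pdivrMr]; lra.
  have := Wout _ _ (Wconv _ _ _ _ _ Wxy Wpq m01).
  have -> : (1 - k / (1 + k)) * x + k / (1 + k) * p = d / (1 + k).
    by rewrite -xE; field.
  have -> : (1 - k / (1 + k)) * y + k / (1 + k) * q = e / (1 + k).
    by rewrite -yE; field.
  apply/negP; rewrite -ltNge; apply: le_lt_trans Dde.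
  rewrite !expr_div_n -mulrDl ler_pdivrMr ?exprn_gt0 ?addr_gt0 //.
  by rewrite ler_peMr ?addr_ge0 ?sqr_ge0 // exprn_ege1 //; lra.
have slopes x y d e x' y' d' e' : W x y -> D d e -> W x' y' -> D d' e' ->
    0 < cross (x - d) (y - e) -> cross (x' - d') (y' - e') < 0 ->
    - dot (x - d) (y - e) / cross (x - d) (y - e) <=
    - dot (x' - d') (y' - e') / cross (x' - d') (y' - e').
  move=> Wxy Dde Wxy' Dde'.
  set c := cross (x - d) _; set c' := cross (x' - d') _ => c_gt0 c'_lt0.
  (* This weight makes [cross] of the combined difference zero, so that [dot_ge0] applies to it. *)
  pose m := c / (c - c').
  have cc'_gt0 : 0 < c - c' by lra.
  have cc'0 : c - c' != 0 by rewrite gt_eqF.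
  have m01 : 0 <= m <= 1.
    by apply/andP; split; [apply: divr_ge0 | rewrite ler_pdivrMr]; lra.
  have [m_ge0 m_le1] := andP m01.
  have Dm : D ((1 - m) * d + m * d') ((1 - m) * e + m * e').
    pose M := Num.max (d ^+ 2 + e ^+ 2) (d' ^+ 2 + e' ^+ 2).
    have M_lt : M < r ^+ 2 by rewrite gt_max; apply/andP.
    apply: le_lt_trans M_lt.
    have : 0 <= (1 - m) * (M - (d ^+ 2 + e ^+ 2)).
      by rewrite mulr_ge0 ?subr_ge0 // le_max lexx.
    have : 0 <= m * (M - (d' ^+ 2 + e' ^+ 2)).
      by rewrite mulr_ge0 ?subr_ge0 // le_max lexx orbT.
    have : 0 <= (1 - m) * m * ((d - d') ^+ 2 + (e - e') ^+ 2).
      by rewrite mulr_ge0 ?addr_ge0 ?sqr_ge0 // mulr_ge0 ?subr_ge0.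
    lra.
  have := dot_ge0 _ _ _ _ (Wconv _ _ _ _ _ Wxy Wxy' m01) Dm.
  have -> : dot ((1 - m) * x + m * x' - ((1 - m) * d + m * d'))
     ((1 - m) * y + m * y' - ((1 - m) * e + m * e'))
     = (c * dot (x' - d') (y' - e') - c' * dot (x - d) (y - e)) / (c - c').
    by rewrite /m /dot; field.
  rewrite pmulr_lge0 ?invr_gt0 // => /(_ _) dd.
  have {}dd : 0 <= c * dot (x' - d') (y' - e') - c' * dot (x - d) (y - e).
    apply: dd; transitivity ((1 - m) * c + m * c'); last by rewrite /m; field.
    by rewrite /c /c' /cross; ring.
  rewrite ler_pdivrMr // -mulrAC ler_ndivlMr //; lra.
(* Functionals equal to [dot] on the line through [(p, q)] are [dot + t cross];
   nonnegativity on [W - D] confines [t] between the two families of slopes. *)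
pose S : set R := fun s => exists x y d e, [/\ W x y, D d e,
  0 < cross (x - d) (y - e) &
  s = - dot (x - d) (y - e) / cross (x - d) (y - e)].
pose t := sup S.
(* Chosen so that [(k * q, - (k * p))] and its opposite lie in [D]; subtracted from [(p, q)] they
   give [cross] both signs, whence [S] is nonempty and bounded above. *)
pose k := r ^+ 2 / 2 / (p ^+ 2 + q ^+ 2).
have k_gt0 : 0 < k by rewrite !divr_gt0 ?exprn_gt0.
have kE : k * (p ^+ 2 + q ^+ 2) = r ^+ 2 / 2 by rewrite /k divfK // gt_eqF.
have k_lt1 : k < 1.
  rewrite /k ltr_pdivrMr //; have := Wout _ _ Wpq; have := exprn_gt0 2 r0; lra.
have r2_gt0 : 0 < r ^+ 2 by rewrite exprn_gt0.
have Dk : D (k * q) (- (k * p)) /\ D (- (k * q)) (k * p).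
  by rewrite /D; split; nra.
have cross_k : cross (p - k * q) (q - - (k * p)) = r ^+ 2 / 2.
  by rewrite -kE /cross; ring.
have cross_Nk : cross (p - - (k * q)) (q - k * p) = - (r ^+ 2 / 2).
  by rewrite -kE /cross; ring.
have S0 : (S !=set0)%classic.
  by eexists; exists p, q, (k * q), (- (k * p)); split=> //; [case: Dk|lra].
have ubS : has_ubound S.
  eexists=> _ [x [y [d [e [Wxy Dde cr ->]]]]].
  apply: (slopes _ _ _ _ p q (- (k * q)) (k * p)) => //; [by case: Dk|lra].
have t_ge x y d e : W x y -> D d e ->
    0 <= dot (x - d) (y - e) + t * cross (x - d) (y - e).
  move=> Wxy Dde; have [cr|cr|cr] := ltgtP (cross (x - d) (y - e)) 0.
  - have : t <= - dot (x - d) (y - e) / cross (x - d) (y - e).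
      apply: ge_sup => // _ [x' [y' [d' [e' [Wxy' Dde' cr' ->]]]]].
      exact: slopes.
    by rewrite ler_ndivlMr //; lra.
  - have : - dot (x - d) (y - e) / cross (x - d) (y - e) <= t.
      by apply: ub_le_sup => //; exists x, y, d, e.
    by rewrite ler_pdivrMr //; lra.
  - by rewrite cr mulr0 addr0 dot_ge0.
(* These are the coefficients of the functional [dot + t cross]. *)
pose u0 := p - t * q; pose v0 := q + t * p.
pose N := Num.sqrt (u0 ^+ 2 + v0 ^+ 2).
have N2 : u0 ^+ 2 + v0 ^+ 2 = (1 + t ^+ 2) * (p ^+ 2 + q ^+ 2).
  by rewrite /u0 /v0; ring.
have N2_gt0 : 0 < u0 ^+ 2 + v0 ^+ 2.
  by rewrite N2 mulr_gt0 // ltr_pwDl ?sqr_ge0.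
have N_gt0 : 0 < N by rewrite sqrtr_gt0.
have NN : N ^+ 2 = u0 ^+ 2 + v0 ^+ 2 by rewrite sqr_sqrtr // ltW.
have uv1 : (u0 / N) ^+ 2 + (v0 / N) ^+ 2 = 1.
  by rewrite !expr_div_n -mulrDl -NN divff // expf_neq0 // gt_eqF.
exists (u0 / N), (v0 / N); split=> // x y Wxy.
set u := u0 / N in uv1 *; set v := v0 / N in uv1 *.
have uv_ge d e : D d e -> u * d + v * e <= u * x + v * y.
  move=> Dde; rewrite -subr_ge0.
  have -> : u * x + v * y - (u * d + v * e) =
      (dot (x - d) (y - e) + t * cross (x - d) (y - e)) / N.
    by rewrite /u /v /u0 /v0 /dot /cross; field; rewrite gt_eqF.
  by rewrite divr_ge0 ?t_ge // ltW.
rewrite leNgt; apply/negP => lt_r.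
have D00 : D 0 0 by rewrite /D; lra.
have ge0 := uv_ge _ _ D00.
(* Midway between the value at [(x, y)] and [r]: the point [m (u, v)] is still in the disc, yet the
   functional is larger there. *)
pose m := (u * x + v * y + r) / 2.
have Dm : D (m * u) (m * v).
  rewrite /D.
  have -> : (m * u) ^+ 2 + (m * v) ^+ 2 = m ^+ 2 * (u ^+ 2 + v ^+ 2) by ring.
  by rewrite uv1 mulr1 /m; nra.
have := uv_ge _ _ Dm.
have -> : u * (m * u) + v * (m * v) = m * (u ^+ 2 + v ^+ 2) by ring.
rewrite uv1 /m; lra.
Qed.

(** * From a separating line to multipliers *)

Theorem theorem7 (R : realType) (n : nat) (A1 A2 : 'M[R]_n)
    (symA1 : A1^T = A1) (symA2 : A2^T = A2)
    (a b : 'cV[R]_n) (a0 b0 : R)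
    (indep : free [:: A1; A2]) (gamma : R) :
  let f1 := quadfun A1 a a0 in
  let f2 := quadfun A2 b b0 in
  let F := @sqsum2 R in
  (forall (x : 'cV[R]_n) (z : 'cV[R]_2),
     f1 x - z 0 0 = 0 /\ f2 x - z 1 0 = 0 -> F z - gamma >= 0)
  <->
  (exists alpha beta : R, forall (x : 'cV[R]_n) (z : 'cV[R]_2),
     F z - gamma + alpha * (f1 x - z 0 0) + beta * (f2 x - z 1 0) >= 0).
Proof.
move=> f1 f2 F; split=> [G1|[al [be G2]] x z [f1z f2z]]; last first.
  by have := G2 x z; rewrite f1z f2z !mulr0 !addr0.
have [g_le0|g_gt0] := leP gamma 0.
  exists 0, 0 => x z; rewrite !mul0r !addr0 subr_ge0 (le_trans g_le0) //.
  by rewrite addr_ge0 ?sqr_ge0.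
have A12_indep (k l : R) : k *: A1 + l *: A2 = 0 -> k = 0 /\ l = 0.
  move=> kl0; have /freeP indep' := indep : free [tuple A1; A2].
  have := indep' (fun i : 'I_2 => [:: k; l]`_i).
  rewrite !big_ord_recl big_ord0 /= addr0 => /(_ kl0) kl.
  by split; [exact: (kl 0)|exact: (kl 1)].
pose r := Num.sqrt gamma.
have r_gt0 : 0 < r by rewrite sqrtr_gt0.
have rr : r ^+ 2 = gamma by rewrite sqr_sqrtr // ltW.
pose W c d := exists x, f1 x = c /\ f2 x = d.
have [||u [v [uv1 uvW]]] := @separate_from_disc R W r r_gt0.
- move=> _ _ _ _ m [x [<- <-]] [y [<- <-]] m01.
  have [z [z1 z2]] :=
    joint_range_convex a b a0 b0 x y symA1 symA2 A12_indep m01.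
  by exists z.
- move=> _ _ [x [<- <-]]; rewrite rr.
  have := G1 x (\col_(i < 2) [:: f1 x; f2 x]`_i).
  by rewrite /F /sqsum2 !mxE /= !subrr subr_ge0; apply.
(* With these multipliers the minimum over [z] is at [r (u, v)]; completing squares leaves
   [2 * r * (u * f1 x + v * f2 x - r)]. *)
exists (2 * r * u), (2 * r * v) => x z.
have Wx : r <= u * f1 x + v * f2 x by apply: uvW; exists x.
have -> : F z - gamma + 2 * r * u * (f1 x - z 0 0) + 2 * r * v * (f2 x - z 1 0)
    = (z 0 0 - r * u) ^+ 2 + (z 1 0 - r * v) ^+ 2
      + 2 * r * (u * f1 x + v * f2 x - r)
      + r ^+ 2 * (1 - (u ^+ 2 + v ^+ 2)) + (r ^+ 2 - gamma).
  by rewrite /F /sqsum2; ring.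
rewrite uv1 rr !subrr mulr0 !addr0 !addr_ge0 ?sqr_ge0 //.
by rewrite !mulr_ge0 ?subr_ge0 // ltW.
Qed.
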